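(* (1) Let $n_1, n_2 \ge 3$ be odd integers. If $h(n_1) = (n_1-1)/2$ and $h(n_2) = (n_2-1)/2$, then $h(n_1 n_2) = (n_1 n_2 - 1)/2$. (2) Let $n \ge 3$ be an odd integer such that there exist both a witness and a $(-1)$-witness in $S_n$. Then, for any odd integer $k \ge 1$, $h(nk) = (nk-1)/2$. (3) Let $n$ be an odd positive integer with prime factors $p$ and $q$ such that $p \equiv 1 \pmod 4$ and $q \equiv 3 \pmod 4$. Then $h(n) = (n-1)/2$.
   Context: $S_n$ and $A_n$ are the symmetric and alternating groups of degree $n$, acting on $\mathbb{Z}_n = \mathbb{Z}/n\mathbb{Z} = \{0,1,\ldots,n-1\}$. Permutations act on the right (the image of $x$ under $\pi$ is $x^\pi$) and are composed from left to right. For $n$ odd, let $c = (0,1,\ldots,n-1) \in A_n$, i.e. $x^c = x+1$. For $\pi \in A_n$, $[\pi] = \langle c\rangle \pi$ is the coset of $\langle c \rangle$ containing $\pi$; its elements are the permutations $c^j\pi$ (first $c^j$, then $\pi$). Define $h(\pi)$ to be the minimum number of 3-cycles in an expression of $\pi$ as a product of (not necessarily disjoint) 3-cycles in $A_n$, with $h(\mathrm{id}) = 0$. Define $h([\pi]) = \min_{\sigma \in [\pi]} h(\sigma) = \min_{0 \le j \le n-1} h(c^j\pi)$ and $h(n) = \max_{\pi \in A_n} h([\pi])$. For $n$ odd, a permutation $\pi \in S_n$ is of witness-type if every element $\tau$ of the coset $\langle c \rangle \pi = \{c^j\pi : 0 \le j \le n-1\}$ has a unique fixed point and every other element of $\{0,1,\ldots,n-1\}$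 lies in a cycle of $\tau$ of even length. A witness is a witness-type permutation that is even; a $(-1)$-witness is a witness-type permutation that is odd. *)

(* Defs.v *)
From mathcomp Require Import all_boot all_order all_fingroup all_solvable.

Set Implicit Arguments.
Unset Strict Implicit.
Unset Printing Implicit Defensive.

Import GroupScope.

(* Permutations of {0, ..., n-1} are the elements of 'S_n = {perm 'I_n}, with
   (s * t) x = t (s x): products are composed from left to right. *)

(* x |-> x + 1 mod n *)
Definition shift (n : nat) : 'S_n := perm (@ordS_inj n).

Definition three_cycle (n : nat) (s : 'S_n) : bool :=
  [exists x, exists y, exists z,
    [&& uniq [:: x; y; z], s x == y, s y == z, s z == x
      & [forall t, (t \notin [:: x; y; z]) ==> (s t == t)]]].

Definition three_cycle_prod (n : nat) (s : 'S_n) (k : nat) : bool :=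
  [exists t : k.-tuple 'S_n,
    all (@three_cycle n) t && (s == \prod_(u <- t) u)].

Lemma three_cycle_prodP (n : nat) (s : 'S_n) (k : nat) :
  reflect (exists t : seq 'S_n,
             [/\ size t = k, all (@three_cycle n) t & s = \prod_(u <- t) u])
          (three_cycle_prod s k).
Proof.
apply: (iffP existsP) => [[t /andP[at3 /eqP ->]]|[t [sz at3 ->]]].
  by exists t; rewrite size_tuple.
by move/eqP: sz => sz; exists (Tuple sz); rewrite at3 eqxx.
Qed.

Lemma three_cycle_prodM (n : nat) (s1 s2 : 'S_n) (k1 k2 : nat) :
  three_cycle_prod s1 k1 -> three_cycle_prod s2 k2 ->
  three_cycle_prod (s1 * s2) (k1 + k2).
Proof.
move=> /three_cycle_prodP[t1 [z1 a1 ->]] /three_cycle_prodP[t2 [z2 a2 ->]].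
apply/three_cycle_prodP; exists (t1 ++ t2).
by rewrite size_cat z1 z2 all_cat a1 a2 big_cat.
Qed.

Lemma three_cycle_prod1 (n : nat) : three_cycle_prod (1 : 'S_n) 0.
Proof. by apply/three_cycle_prodP; exists [::]; rewrite big_nil. Qed.

Lemma three_cycle_tperm (n : nat) (x y z : 'I_n) :
  uniq [:: x; y; z] -> three_cycle (tperm x y * tperm x z).
Proof.
move=> U; apply/existsP; exists x; apply/existsP; exists y; apply/existsP.
exists z; rewrite U /=.
move: U; rewrite /= !inE !andbT negb_or => /andP[/andP[xy xz] yz].
rewrite !permM tpermL tpermR tpermL (tpermD xz yz) tpermR.
rewrite (@tpermD _ x z y) // 1?[z == y]eq_sym // !eqxx /=.
apply/forallP=> t; apply/implyP; rewrite !inE !negb_or => /and3P[tx ty tz].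
by rewrite permM !tpermD // eq_sym.
Qed.

Lemma three_cycle_prod_tperm_shared (n : nat) (x y z : 'I_n) :
  x != y -> x != z -> exists k, three_cycle_prod (tperm x y * tperm x z) k.
Proof.
move=> xy xz; have [<-|yz] := eqVneq y z.
  by exists 0; rewrite tperm2 three_cycle_prod1.
exists 1%N; apply/three_cycle_prodP; exists [:: tperm x y * tperm x z].
split=> //; last by rewrite big_seq1.
by rewrite /= andbT three_cycle_tperm //= !inE negb_or xy xz yz.
Qed.

Lemma three_cycle_prod_tperm (n : nat) (a b c d : 'I_n) :
  a != b -> c != d -> exists k, three_cycle_prod (tperm a b * tperm c d) k.
Proof.
move=> ab; have [<-|ac cd] := eqVneq a c.
  exact: three_cycle_prod_tperm_shared.
have [k1 H1] := three_cycle_prod_tperm_shared ab ac.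
have ca : c != a by rewrite eq_sym.
have [k2 H2] := three_cycle_prod_tperm_shared ca cd.
exists (k1 + k2); have := three_cycle_prodM H1 H2.
by rewrite (tpermC c a) -mulgA (mulgA (tperm a c)) tperm2 mul1g.
Qed.

Lemma Alt_three_cycle_prod (n : nat) (s : 'S_n) :
  s \in 'Alt_('I_n) -> exists k, three_cycle_prod s k.
Proof.
rewrite Alt_even; have [ts -> dts] := prod_tpermP s.
rewrite odd_perm_prod //.
have [m] := ubnP (size ts); elim: m ts dts => // m IHm [|[a b] [|[c d] ts]] //=.
  by move=> _ _ _; exists 0; rewrite big_nil three_cycle_prod1.
move=> /and3P[ab cd dts] lem; rewrite negbK => ev.
have [k1 H1] := three_cycle_prod_tperm ab cd.
have [k2 H2] := IHm ts dts (ltnW lem) ev.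
by exists (k1 + k2); rewrite !big_cons mulgA three_cycle_prodM.
Qed.

Lemma h_perm_subproof (n : nat) (s : 'S_n) :
  exists k, (s \in 'Alt_('I_n)) ==> three_cycle_prod s k.
Proof.
have [sA|_] := boolP (s \in 'Alt_('I_n)); last by exists 0.
exact: Alt_three_cycle_prod.
Qed.

(* h(s), meaningful for s in the alternating group; odd permutations, which are
   not products of 3-cycles, get the dummy value 0. *)
Definition h_perm (n : nat) (s : 'S_n) : nat := ex_minn (h_perm_subproof s).

(* h([s]); for n odd, shift n is even, so the coset of an even s consists of
   even permutations. *)
Definition h_coset (n : nat) (s : 'S_n) : nat :=
  h_perm [arg min_(t < s in <[shift n]> :* s) h_perm t].

Definition h (n : nat) : nat := \max_(s in 'Alt_('I_n)) h_coset s.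

Definition witness_type (n : nat) (s : 'S_n) : Prop :=
  forall t : 'S_n, t \in <[shift n]> :* s ->
    exists x : 'I_n,
      [/\ t x = x,
          forall y : 'I_n, t y = y -> y = x
        & forall y : 'I_n, y != x -> ~~ odd #|porbit t y|].

Definition witness (n : nat) (s : 'S_n) : Prop :=
  witness_type s /\ ~~ odd_perm s.

Definition neg_witness (n : nat) (s : 'S_n) : Prop :=
  witness_type s /\ odd_perm s.

(* Main.v *)
Require Import Defs.
From mathcomp Require Import all_boot all_order all_fingroup all_solvable.
From mathcomp Require Import all_algebra all_field.
From mathcomp Require Import zify.

(* A 3-cycle is a product of two transpositions sharing a point, which changes
   the number of odd cycles by at most 2, and a suitable one raises it by 2.
   Hence an even permutation of n points with o odd cycles has h = (n - o) / 2.
   For n odd, h(n) = (n - 1) / 2 therefore means that every element of some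
   coset <c> s has a single odd cycle; since exactly one element of the coset
   fixes a given point, that cycle must be a fixed point, so s is a witness.
   Writing the points of Z_(n1 n2) as a + n1 b, two permutations of witness
   type acting separately on the digits a and b yield one on Z_(n1 n2), whose
   sign is the product of the signs. The map x |-> - x is of witness type for
   every odd n, with sign (-1)^((n - 1) / 2), and multiplication by a primitive
   root modulo an odd prime is a (-1)-witness. *)

Set Implicit Arguments.
Unset Strict Implicit.
Unset Printing Implicit Defensive.

Local Open Scope group_scope.

(** * Odd cycles under multiplication by transpositions *)

Section OddOrbits.

Variable T : finType.
Implicit Types (s : {perm T}) (x y z : T).

Definition odd_orbits s := #|[set X in porbits s | odd #|X|]|.

Lemma mem_porbits s x : porbit s x \in porbits s.
Proof. exact: imset_f. Qed.

Lemma eq_porbit_of_mem s X x : X \in porbits s -> x \in X -> X = porbit s x.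
Proof.
by move=> /imsetP[z _ ->] xz; apply/eqP; rewrite eq_porbit_mem porbit_sym.
Qed.

Lemma sum_card_porbits s : \sum_(X in porbits s) #|X| = #|T|.
Proof.
have trivO : trivIset (porbits s).
  apply/trivIsetP => X Y XO YO; apply: contraNT => /pred0Pn[z /andP[zX zY]].
  by rewrite (eq_porbit_of_mem XO zX) (eq_porbit_of_mem YO zY).
rewrite (eqP trivO) -cardsT; apply: eq_card => z; rewrite inE.
by apply/bigcupP; exists (porbit s z); rewrite ?mem_porbits ?porbit_id.
Qed.

Lemma odd_odd_orbits s : odd (odd_orbits s) = odd #|T|.
Proof.
rewrite -(sum_card_porbits s) /odd_orbits -sum1_card.
rewrite (big_morph odd oddD (erefl : odd 0 = false)).
rewrite (big_morph odd oddD (erefl : odd 0 = false)).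
rewrite (eq_bigl _ _ (fun X => in_set _ X)) big_mkcondr /=.
by apply: eq_bigr => X _; case: odd.
Qed.

Lemma odd_orbits_le s : odd_orbits s <= #|T|.
Proof.
rewrite (leq_trans _ (leq_imset_card (porbit s) _)) // subset_leq_card //.
by apply/subsetP => X; rewrite inE => /andP[].
Qed.

Lemma odd_orbits1 : odd_orbits 1 = #|T|.
Proof.
have o1 x : porbit 1 x = [set x].
  by rewrite porbit.unlock cycle1 imset_set1 /aperm perm1.
rewrite -[RHS](card_imset _ (@set1_inj T)); apply: eq_card => X.
rewrite inE; apply/andP/imsetP => [[/imsetP[x _ ->] _]|[x _ ->]].
  by exists x.
by rewrite -{1}o1 mem_porbits cards1.
Qed.

Lemma porbit_tpermM_eq s x y z :
    x \notin porbit s z -> y \notin porbit s z ->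
  porbit (tperm x y * s) z = porbit s z.
Proof.
move=> xz yz.
have e i : ((tperm x y * s) ^+ i) z = (s ^+ i) z.
  elim: i => [|i IH]; first by rewrite !perm1.
  rewrite !expgSr !permM IH tpermD //.
    by apply: contraNneq xz => ->; apply: mem_porbit.
  by apply: contraNneq yz => ->; apply: mem_porbit.
by apply/porbit_setP=> w; apply/porbitP/porbitP => -[i ->]; exists i.
Qed.

(** [porbits_mul_tperm] is applied to [s] and to [tperm x y * s]. Adding the two cycle counts shows
    that exactly one of the two permutations has [x] and [y] in a common cycle. *)
Lemma mem_porbit_tpermM s x y :
  x != y -> (y \in porbit (tperm x y * s) x) = (y \notin porbit s x).
Proof.
move=> xy; have := porbits_mul_tperm s x y.
have := porbits_mul_tperm (tperm x y * s) x y.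
rewrite /= tpermKg xy /= ![x \in _]porbit_sym => e1 e2.
by move: e1 e2; do 2!case: (y \in _) => //=; lia.
Qed.

Lemma porbitU_tpermM s x y :
  porbit (tperm x y * s) x :|: porbit (tperm x y * s) y
    = porbit s x :|: porbit s y.
Proof.
(* Multiplication by [tperm x y] is an involution, so one inclusion for all [u] suffices. *)
suff sub u : porbit (tperm x y * u) x :|: porbit (tperm x y * u) y
    \subset porbit u x :|: porbit u y.
  by apply/eqP; rewrite eqEsubset sub -{1 2}(tpermKg x y s) sub.
apply/subsetP => z; apply: contraLR.
rewrite !inE ![z \in _]porbit_sym !negb_or => /andP[xz yz].
by rewrite porbit_tpermM_eq ?xz.
Qed.

(** Separates the cycles through [x] or [y] from the rest, which [tperm x y] leaves alone. *)
Lemma odd_orbits_split s x y : odd_orbits s =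
  #|[set X in porbits s | [&& odd #|X|, x \notin X & y \notin X]]|
    + odd #|porbit s x| + (y \notin porbit s x) * odd #|porbit s y|.
Proof.
pose A := [set X in porbits s | odd #|X| && (x \notin X)].
have -> : odd_orbits s = #|A| + odd #|porbit s x|.
  rewrite /odd_orbits (cardsD1 (porbit s x)) inE mem_porbits addnC /=.
  congr (_ + _); apply: eq_card => X; rewrite !inE andbC -!andbA.
  have [XO|] := boolP (X \in porbits s) => //=; congr (_ && _).
  apply/negP/idP => [h|/negP h /eqP e]; last first.
    by apply: h; rewrite e porbit_id.
  by apply/negP => xX; apply: h; rewrite -(eq_porbit_of_mem XO xX).
rewrite addnAC; congr (_ + _).
rewrite (cardsD1 (porbit s y)) inE mem_porbits [x \in _]porbit_sym addnC /=.
congr (_ + _); last by case: odd; case: (_ \in _).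
apply: eq_card => X; rewrite !inE andbC -!andbA.
have [XO|] := boolP (X \in porbits s) => //=; congr [&& _, _ & _].
apply/negP/idP => [h|/negP h /eqP e]; last first.
  by apply: h; rewrite e porbit_id.
by apply/negP => yX; apply: h; rewrite -(eq_porbit_of_mem XO yX).
Qed.

Lemma porbits_avoiding_tpermM s x y X :
  [&& X \in porbits (tperm x y * s), x \notin X & y \notin X]
    = [&& X \in porbits s, x \notin X & y \notin X].
Proof.
suff sub u : [&& X \in porbits u, x \notin X & y \notin X] ->
    [&& X \in porbits (tperm x y * u), x \notin X & y \notin X].
  by apply/idP/idP; [rewrite -{2}(tpermKg x y s)|]; apply: sub.
move=> /and3P[/imsetP[z _ ->] xz yz].
by rewrite xz yz -(porbit_tpermM_eq xz yz) mem_porbits.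
Qed.

(** Splitting a cycle of length a + b into lengths a and b changes the odd count only if a and b are
    both odd, when an even cycle yields two odd ones. *)
Lemma odd_orbits_tpermM s x y (u := tperm x y * s) :
    x != y -> y \in porbit s x ->
  #|porbit s x| = #|porbit u x| + #|porbit u y|
  /\ odd_orbits u = odd_orbits s + (odd #|porbit u x| && odd #|porbit u y|).*2.
Proof.
move=> xy sy; have := mem_porbit_tpermM s xy; rewrite sy /= -/u => uy.
have cU : #|porbit s x| = #|porbit u x| + #|porbit u y|.
  have <- : porbit u x :|: porbit u y = porbit s x.
    move: sy; rewrite porbitU_tpermM -eq_porbit_mem => /eqP ->.
    exact: setUid.
  rewrite cardsU disjoint_setI0 ?cards0 ?subn0 // -setI_eq0.
  apply/eqP/setP=> z; rewrite !inE; apply/negP => /andP[].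
  by rewrite -!eq_porbit_mem => /eqP -> ; rewrite eq_porbit_mem porbit_sym uy.
split=> //; rewrite (odd_orbits_split s x y) (odd_orbits_split u x y) uy sy.
have -> : [set X in porbits u | [&& odd #|X|, x \notin X & y \notin X]]
    = [set X in porbits s | [&& odd #|X|, x \notin X & y \notin X]].
  apply/setP=> X; rewrite !inE; have := porbits_avoiding_tpermM s x y X.
  rewrite -/u; case: (odd _); rewrite ?andbF //=.
rewrite mul1n mul0n addn0 -!addnA cU oddD.
by case: odd; case: odd.
Qed.

(* The count could only rise by 4 if both transpositions split an even cycle
   into odd ones; but the first split puts x in an odd cycle. *)
Lemma odd_orbits_tpermMM_le s x y z :
    x != y -> x != z ->
  odd_orbits (tperm x y * (tperm x z * s)) <= odd_orbits s + 2.
Proof.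
move=> xy xz; set s1 := tperm x z * s; set s2 := tperm x y * s1.
have le2 : odd_orbits s2 <= odd_orbits s1 + (~~ odd #|porbit s1 x|).*2.
  have [h|h] := boolP (y \in porbit s1 x).
    have [] := odd_orbits_tpermM xy h; rewrite -/s2 => -> ->.
    rewrite oddD.
    by case: (odd #|porbit s2 x|); case: (odd #|porbit s2 y|) => /=; lia.
  (* Joining two cycles is read as a split in reverse, so it cannot raise the count. *)
  rewrite -mem_porbit_tpermM // in h.
  have [_] := odd_orbits_tpermM xy h; rewrite [_ * s2]tpermKg -/s1 => ->.
  by rewrite -addnA leq_addr.
have [h|h] := boolP (z \in porbit s x).
  have [_ e1] := odd_orbits_tpermM xz h; rewrite -/s1 in e1.
  move: le2; rewrite e1.
  by case: (odd #|porbit s1 x|); case: (odd #|porbit s1 z|) => /=; lia.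
rewrite -mem_porbit_tpermM // in h.
have [_] := odd_orbits_tpermM xz h; rewrite [_ * s1]tpermKg => e1.
have le1 : odd_orbits s1 <= odd_orbits s by rewrite e1 leq_addr.
by move: le2; case: (odd #|porbit s1 x|) => /=; lia.
Qed.

Lemma odd_orbits_tpermMM_ge s x y z :
    x != y -> x != z ->
  odd_orbits s <= odd_orbits (tperm x y * (tperm x z * s)) + 2.
Proof.
move=> xy xz; rewrite -{1}[s](tpermKg x z) -{1}[_ * s](tpermKg x y).
exact: odd_orbits_tpermMM_le.
Qed.

(** The sign is the parity of the number of points plus the number of cycles. If all cycles are odd,
    these two numbers have the same parity. *)
Lemma even_porbits_even_perm s :
  (forall x, odd #|porbit s x|) -> odd_perm s = false.
Proof.
move=> ods; rewrite /odd_perm -(odd_odd_orbits s) /odd_orbits.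
rewrite (_ : [set X in _ | _] = porbits s) ?addbb //.
by apply/setP=> X; rewrite inE andb_idr // => /imsetP[x _ ->].
Qed.

Lemma porbit_fix s x : s x = x -> porbit s x = [set x].
Proof.
move=> sx; apply/setP=> y; rewrite inE; apply/porbitP/eqP => [[i ->]|->].
  by elim: i => [|i IH]; rewrite ?perm1 // expgSr permM IH.
by exists 0; rewrite perm1.
Qed.

(** Taking [y] to be the predecessor of [x] cuts [x] off as a fixed point. *)
Lemma odd_orbits_tperm_split s x (y := s^-1 x) (u := tperm x y * s) :
  s x != x ->
  [/\ x != y, u x = x, #|porbit s x| = #|porbit u y|.+1
    & odd_orbits u = odd_orbits s + (odd #|porbit u y|).*2].
Proof.
move=> sx; have xy : x != y.
  by apply: contraNneq sx => e; rewrite {1}e permKV.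
have ux : u x = x by rewrite permM tpermL permKV.
have sy : y \in porbit s x by rewrite -porbitV (mem_porbit _ 1).
have [] := odd_orbits_tpermM xy sy.
by rewrite -/u (porbit_fix ux) cards1 add1n.
Qed.

(* Either shorten an odd cycle by two points, or turn two even cycles into
   a fixed point and an odd cycle. *)
Lemma odd_orbits_tpermMM_incr s :
    odd_perm s = false -> s != 1 ->
  exists x y z, [/\ uniq [:: x; y; z] &
    odd_orbits (tperm x y * (tperm x z * s)) = odd_orbits s + 2].
Proof.
move=> ev s1.
have [x ex|ods] := pickP (fun x => ~~ odd #|porbit s x|).
  have sx : s x != x.
    by apply: contraNneq ex => /porbit_fix ->; rewrite cards1.
  have [xy ux cx ou] := odd_orbits_tperm_split sx.
  set y := s^-1 x in xy ux cx ou; set u := tperm x y * s in ux cx ou.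
  have uy : odd #|porbit u y| by move: ex; rewrite cx /= negbK.
  (* [u] is an odd permutation, so it has an even cycle; joining the fixed point [x] to it trades
     one odd cycle for another. *)
  have [z ez|odu] := pickP (fun x => ~~ odd #|porbit u x|); last first.
    have : odd_perm u = false.
      by apply: even_porbits_even_perm => z; apply: negbFE.
    by rewrite odd_permM odd_tperm ev xy.
  have xz : x != z.
    by apply: contraNneq ez => <-; rewrite (porbit_fix ux) cards1.
  have zy : z != y by apply: contraNneq ez => ->.
  exists x, z, y; split.
    by rewrite /= !inE negb_or xz xy zy.
  rewrite -/u.
  have h : z \notin porbit u x by rewrite (porbit_fix ux) inE eq_sym.
  rewrite -mem_porbit_tpermM // in h.
  have [_] := odd_orbits_tpermM xz h; rewrite tpermKg (negbTE ez) andbF.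
  by rewrite ou uy addn0.
(* All cycles are odd here, so a moved point lies on a cycle of length at least 3, from which two
   consecutive points are cut off. *)
have [x sx|fx] := pickP (fun x => s x != x); last first.
  case/eqP: s1; apply/permP=> x; rewrite perm1; apply/eqP/negbFE/fx.
have [xy ux cx ou] := odd_orbits_tperm_split sx.
set y := s^-1 x in xy ux cx ou; set u := tperm x y * s in ux cx ou.
have uy : odd #|porbit u y| = false.
  by have := ods x; rewrite cx /= negbK.
have uyy : u y != y.
  by apply: contraFneq uy => /porbit_fix ->; rewrite cards1.
have [yz uz cy ov] := odd_orbits_tperm_split uyy.
set z := u^-1 y in yz uz cy ov.
have zx : z != x.
  by rewrite /z -[X in _ != X](permK u) (inj_eq perm_inj) ux eq_sym.
exists y, z, x; split.
  by rewrite /= !inE negb_or yz zx eq_sym xy.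
rewrite [tperm y x]tpermC ov ou uy addn0.
by move: uy; rewrite cy /= => /negbFE ->.
Qed.

End OddOrbits.

(** * The 3-cycle length in terms of odd cycles *)

Lemma three_cycleP n (u : 'S_n) :
  reflect (exists x y z, uniq [:: x; y; z] /\ u = tperm x y * tperm x z)
          (three_cycle u).
Proof.
apply: (iffP idP) => [|[x [y [z [U ->]]]]]; last exact: three_cycle_tperm.
move=> /existsP[x /existsP[y /existsP[z]]].
move=> /and5P[U /eqP ux /eqP uy /eqP uz /forallP ut].
exists x, y, z; split=> //; apply/permP=> t; rewrite permM.
have [xy xz yz] : [/\ x != y, x != z & y != z].
  by move: U; rewrite /= !inE negb_or andbT -andbA => /and3P.
have /implyP := ut t; rewrite !inE !negb_or.
have [->|tx] := eqVneq t x; first by rewrite tpermL tpermD // eq_sym.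
have [->|ty] := eqVneq t y; first by rewrite tpermR tpermL.
have [->|tz] := eqVneq t z; first by rewrite [tperm x y z]tpermD // tpermR.
by move=> /(_ isT)/eqP ->; rewrite !tpermD // eq_sym.
Qed.

(** The identity has n odd cycles, and each factor lowers their number by at most 2. *)
Lemma three_cycle_prod_odd_orbits n (s : 'S_n) k :
  three_cycle_prod s k -> n <= odd_orbits s + k.*2.
Proof.
move=> /three_cycle_prodP[t [<- at3 ->]] {s k}.
elim: t at3 => [_|u t IH /= /andP[/three_cycleP[x [y [z [U ->]]]] /IH {}IH]].
  by rewrite big_nil odd_orbits1 card_ord addn0.
rewrite big_cons -mulgA.
move: U; rewrite /= !inE negb_or andbT -andbA => /and3P[xy xz _].
apply: leq_trans IH _; rewrite doubleS -addn2 addnA [leqRHS]addnAC leq_add2r.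
exact: odd_orbits_tpermMM_ge.
Qed.

Lemma odd_orbits_three_cycle_prod n (s : 'S_n) :
  odd_perm s = false ->
  exists2 k, three_cycle_prod s k & n = odd_orbits s + k.*2.
Proof.
have [m] := ubnP (n - odd_orbits s); elim: m s => // m IH s lem ev.
have [->|s1] := eqVneq s 1.
  by exists 0; rewrite ?three_cycle_prod1 // odd_orbits1 card_ord addn0.
have [x [y [z [U e]]]] := odd_orbits_tpermMM_incr ev s1.
have := odd_orbits_le (tperm x y * (tperm x z * s)); rewrite card_ord => le.
have [||k sk dn] := IH (tperm x y * (tperm x z * s)).
- by move: lem le; rewrite e; lia.
- have: uniq [:: x; y; z] by [].
  rewrite /= !inE negb_or andbT -andbA => /and3P[xy xz _].
  by rewrite !odd_permM !odd_tperm xy xz ev.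
exists k.+1; last by rewrite [LHS]dn e; lia.
(* The factor split off is the inverse of the 3-cycle that raised the count. *)
have -> : s = (tperm x z * tperm x y) * (tperm x y * (tperm x z * s)).
  by rewrite -mulgA tpermKg tpermKg.
rewrite -add1n; apply: three_cycle_prodM sk; apply/three_cycle_prodP.
exists [:: tperm x z * tperm x y]; rewrite big_seq1 /= andbT; split=> //.
apply: three_cycle_tperm; move: U; rewrite /= !inE !negb_or !andbT.
by rewrite [z == y]eq_sym => /andP[/andP[-> ->] ->].
Qed.

Lemma h_permE n (s : 'S_n) :
  odd_perm s = false -> n = odd_orbits s + (h_perm s).*2.
Proof.
move=> ev; have [k sk dn] := odd_orbits_three_cycle_prod ev.
have sA : s \in 'Alt_('I_n) by rewrite Alt_even ev.
rewrite /h_perm; case: ex_minnP => m; rewrite sA /= => sm /(_ k sk) le_mk.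
by have := three_cycle_prod_odd_orbits sm; lia.
Qed.

(** * Cosets of the shift and the witness criterion *)

Lemma val_shiftX n j (x : 'I_n) : val ((shift n ^+ j) x) = (x + j) %% n.
Proof.
elim: j => [|j IH]; first by rewrite perm1 addn0 modn_small.
by rewrite expgSr permM permE /= IH -addn1 modnDml -addnA addn1.
Qed.

(** The shift has odd order dividing n, hence sign 1. *)
Lemma odd_shiftX n j : odd n -> odd_perm (shift n ^+ j) = false.
Proof.
move=> on; have oX k (s : 'S_n) : odd_perm (s ^+ k) = odd k && odd_perm s.
  elim: k => [|k IH]; first by rewrite odd_perm1.
  by rewrite expgS odd_permM IH oddS; case: (odd k); case: (odd_perm s).
have : shift n ^+ n = 1.
  by apply/permP=> x; apply/val_inj; rewrite val_shiftX perm1 modnDr modn_small.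
move/(congr1 (@odd_perm _)); rewrite oX on odd_perm1 oX /= => ->.
by rewrite andbF.
Qed.

Lemma mem_shift_coset n (s t : 'S_n) :
  reflect (exists j, t = shift n ^+ j * s) (t \in <[shift n]> :* s).
Proof.
apply: (iffP rcosetP) => [[_ /cycleP[j ->] ->]|[j ->]]; first by exists j.
by exists (shift n ^+ j); rewrite // mem_cycle.
Qed.

Lemma odd_perm_shift_coset n (s t : 'S_n) :
  odd n -> t \in <[shift n]> :* s -> odd_perm t = odd_perm s.
Proof. by move=> on /mem_shift_coset[j ->]; rewrite odd_permM odd_shiftX. Qed.

Lemma odd_orbits_eq1 n (t : 'S_n) x :
    t x = x ->
  reflect (forall y, y != x -> ~~ odd #|porbit t y|) (odd_orbits t == 1%N).
Proof.
move=> tx; have xO : porbit t x \in [set X in porbits t | odd #|X|].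
  by rewrite inE mem_porbits porbit_fix ?cards1.
apply: (iffP idP) => [/cards1P[X eX] y|evt].
  apply: contra => oy; move: xO; rewrite eX inE => /eqP e.
  have : porbit t y \in [set X] by rewrite -eX inE mem_porbits.
  by rewrite inE -e (porbit_fix tx) => /eqP e'; rewrite -in_set1 -e' porbit_id.
apply/cards1P; exists (porbit t x); apply/setP=> X; rewrite inE [RHS]inE.
apply/andP/eqP => [[/imsetP[y _ ->]]|->].
  by apply: contraTeq => ne; apply: evt; apply: contraNneq ne => ->.
by move: xO; rewrite inE => /andP.
Qed.

Lemma odd_orbits_gt0 n (s : 'S_n) : odd n -> 0 < odd_orbits s.
Proof. by move=> on; rewrite odd_gt0 // odd_odd_orbits card_ord. Qed.

Lemma h_perm_le n (s : 'S_n) :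
  odd n -> odd_perm s = false -> h_perm s <= (n - 1) %/ 2.
Proof.
move=> on /h_permE; have := odd_orbits_gt0 s on; rewrite divn2; lia.
Qed.

Lemma h_perm_max n (s : 'S_n) :
    odd n -> odd_perm s = false ->
  (h_perm s == (n - 1) %/ 2) = (odd_orbits s == 1%N).
Proof.
move=> on ev; have := h_permE ev; have := odd_orbits_gt0 s on.
have : odd (odd_orbits s) by rewrite odd_odd_orbits card_ord.
rewrite divn2; lia.
Qed.

Lemma h_le n : odd n -> h n <= (n - 1) %/ 2.
Proof.
move=> on; apply/bigmax_leqP => s; rewrite Alt_even => /negbTE ev.
rewrite /h_coset; case: arg_minnP => [|t ts _]; first exact: rcoset_refl.
by apply: h_perm_le; rewrite // (odd_perm_shift_coset on ts).
Qed.

(* Each point x is fixed by exactly one element of the coset, so x |-> that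
   element is injective hence onto. *)
Lemma shift_coset_fix n (s : 'S_n) :
    0 < n ->
    (forall t x y, t \in <[shift n]> :* s -> t x = x -> t y = y -> x = y) ->
  forall t, t \in <[shift n]> :* s -> exists x, t x = x.
Proof.
move=> n0 fix1 t /mem_shift_coset[j ->].
(* [f x] is the exponent of the shift that carries [x] to [s^-1 x]. *)
pose f (x : 'I_n) := Ordinal (ltn_pmod (s^-1 x + (n - x)) n0).
have fP x k : k = f x %[mod n] -> (shift n ^+ k * s) x = x.
  move=> e; rewrite permM -[RHS](permKV s); congr (s _); apply/val_inj.
  rewrite val_shiftX -modnDmr e modn_mod modnDmr.
  by rewrite addnCA subnKC ?modnDr ?modn_small // ltnW.
have injf : injective f.
  move=> x y e; apply: (fix1 (shift n ^+ f x * s)); last 2 first.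
  - exact: fP.
  - by apply: fP; rewrite e.
  by apply/mem_shift_coset; exists (f x).
have /codomP[x e] := injF_onto injf (Ordinal (ltn_pmod j n0)).
by exists x; apply: fP; rewrite -e /= modn_mod.
Qed.

Lemma h_max_witness n : odd n -> h n = (n - 1) %/ 2 <-> exists s : 'S_n, witness s.
Proof.
move=> on; split=> [hn|[s [ws /negbTE ev]]]; last first.
  apply/eqP; rewrite eqn_leq h_le // /h.
  have sA : s \in 'Alt_('I_n) by rewrite Alt_even ev.
  apply: (bigmax_sup s) => //.
  rewrite /h_coset; case: arg_minnP => [|t ts _]; first exact: rcoset_refl.
  have [x [tx _ evt]] := ws t ts.
  have et : odd_perm t = false by rewrite (odd_perm_shift_coset on ts).
  have : odd_orbits t == 1%N by apply/(odd_orbits_eq1 tx).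
  by rewrite -h_perm_max // => /eqP ->.
have A0 : 0 < #|'Alt_('I_n)| by apply/card_gt0P; exists 1; apply: group1.
have [s sA] := eq_bigmax_cond (@h_coset n) A0; rewrite -/(h n) hn => hs.
move: (sA); rewrite Alt_even => /negbTE ev.
(* In a coset attaining the maximum, the minimum equals the upper bound valid for every element, so
   all elements attain it. *)
have odd1 t : t \in <[shift n]> :* s -> odd_orbits t == 1%N.
  move=> ts.
  have et : odd_perm t = false by rewrite (odd_perm_shift_coset on ts).
  rewrite -h_perm_max // eqn_leq h_perm_le //= hs /h_coset.
  by case: arg_minnP => [|t' _ ]; [apply: rcoset_refl | apply].
(* Two fixed points would be two odd cycles. *)
have fix1 t x y : t \in <[shift n]> :* s -> t x = x -> t y = y -> x = y.
  move=> ts tx ty; apply/eqP; rewrite eq_sym; apply: contraT => yx.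
  have /(odd_orbits_eq1 tx)/(_ y yx) := odd1 t ts.
  by rewrite porbit_fix // cards1.
exists s; split; last by rewrite ev.
move=> t ts; have [x tx] := shift_coset_fix (odd_gt0 on) fix1 ts.
exists x; split=> // [y ty|]; first exact: fix1 ts ty tx.
exact/(odd_orbits_eq1 tx)/odd1.
Qed.

(** * Return times and fibred permutations *)

Lemma expg_porbit (T : finType) (s : {perm T}) x i :
  ((s ^+ i) x == x) = (#|porbit s x| %| i).
Proof.
set m := #|porbit s x|.
have m0 : 0 < m by rewrite lt0n card_porbit_neq0.
have fixm k : (s ^+ (k * m)) x = x.
  elim: k => [|k IH]; first by rewrite perm1.
  by rewrite mulSn expgD permM [(s ^+ m) x]permX iter_porbit.
rewrite {1}(divn_eq i m) expgD permM fixm /dvdn permX.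
have r_lt : i %% m < m by rewrite ltn_mod.
have := nth_uniq x _ _ (uniq_traject_porbit s x).
rewrite size_traject -/m => /(_ _ _ r_lt m0).
by rewrite !nth_traject.
Qed.

(** Evenness in terms of return times passes from a factor to a product without computing the cycles
    of the product. *)
Lemma even_porbitP (T : finType) (s : {perm T}) x :
  reflect (forall i, (s ^+ i) x = x -> ~~ odd i) (~~ odd #|porbit s x|).
Proof.
apply: (iffP idP) => [ev i /eqP|]; last first.
  by apply; apply/eqP; rewrite expg_porbit.
by rewrite expg_porbit => /dvdnP[k ->]; rewrite oddM negb_and ev orbT.
Qed.

(** Through [g], [t] consists of [#|B|] disjoint copies of [s], so its sign is that of [s] to an odd
    power. Both the points and the cycles are multiplied by [#|B|]. *)
Lemma odd_perm_fibred (A B Y : finType) (g : A -> B -> Y)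
    (s : {perm A}) (t : {perm Y}) :
    (forall a b a' b', g a b = g a' b' -> a = a' /\ b = b') ->
    (forall y, exists a b, y = g a b) ->
    (forall a b, t (g a b) = g (s a) b) ->
  odd #|B| -> odd_perm t = odd_perm s.
Proof.
move=> gI gS tg oB.
have tgX i a b : (t ^+ i) (g a b) = g ((s ^+ i) a) b.
  by elim: i => [|i IH]; rewrite ?perm1 // !expgSr !permM IH tg.
have cY : #|Y| = (#|A| * #|B|)%N.
  have gJ : injective (fun u : (A * B)%type => g u.1 u.2).
    by move=> [a b] [a' b'] /gI /= [-> ->].
  rewrite -card_prod -(card_imset _ gJ); apply: eq_card => y.
  by have [a [b ->]] := gS y; rewrite (imset_f _ (_ : (a, b) \in _)).
pose G (u : ({set A} * B)%type) := [set g a u.2 | a in u.1].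
have memG X a b : (g a b \in G (X, b)) = (a \in X).
  apply/imsetP/idP => [[a' a'X /gI[-> _]] //|aX]; by exists a.
have oG a b : porbit t (g a b) = G (porbit s a, b).
  apply/setP=> y; apply/porbitP/imsetP => [[i ->]|[a' /porbitP[i ->] ->]].
    by exists ((s ^+ i) a); rewrite ?mem_porbit.
  by exists i.
have cO : #|porbits t| = (#|porbits s| * #|B|)%N.
  rewrite -[#|B|]cardsT -cardsX -(card_in_imset (f := G)).
    apply: eq_card => X; apply/imsetP/imsetP.
      move=> [y _ ->]; have [a [b ->]] := gS y.
      by exists (porbit s a, b); rewrite ?oG // !inE mem_porbits.
    move=> [[Z b]]; rewrite !inE /= andbT => /imsetP[a _ ->] ->.
    by exists (g a b).
  move=> [X b] [X' b']; rewrite !inE !andbT /=.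
  move=> /imsetP[a _ ->] /imsetP[a' _ ->].
  (* A cycle is nonempty, so any point of its copy determines the label [b]. *)
  move=> e; have : g a b \in G (porbit s a', b') by rewrite -e memG porbit_id.
  move=> /imsetP[a'' _ /gI[_ /= bb]]; rewrite -bb; congr (_, _).
  by apply/setP=> z; rewrite -(memG _ z b) e -bb memG.
by rewrite /odd_perm cY cO !oddM oB !andbT.
Qed.

(** * Permutations acting on digits *)

Section Product.

Variables (n1 n2 : nat) (s1 : 'S_n1) (s2 : 'S_n2).
Hypothesis n1_gt0 : 0 < n1.

Definition lowdigit (y : 'I_(n1 * n2)%N) : 'I_n1 := Ordinal (ltn_pmod y n1_gt0).

Fact highdigit_subproof (y : 'I_(n1 * n2)%N) : y %/ n1 < n2.
Proof. by rewrite ltn_divLR // [ltnRHS]mulnC. Qed.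
Definition highdigit y : 'I_n2 := Ordinal (highdigit_subproof y).

Fact of_digits_subproof (a : 'I_n1) (b : 'I_n2) : (b * n1 + a < n1 * n2)%N.
Proof.
apply: (@leq_trans (b.+1 * n1)%N); first by rewrite mulSn addnC ltn_add2r.
by rewrite mulnC leq_mul2l ltn_ord orbT.
Qed.
Definition of_digits a b : 'I_(n1 * n2)%N := Ordinal (of_digits_subproof a b).

Lemma of_digitsK1 a b : lowdigit (of_digits a b) = a.
Proof. by apply/val_inj; rewrite /= modnMDl modn_small. Qed.

Lemma of_digitsK2 a b : highdigit (of_digits a b) = b.
Proof. by apply/val_inj; rewrite /= divnMDl // divn_small ?addn0. Qed.

Lemma digitsK y : of_digits (lowdigit y) (highdigit y) = y.
Proof. by apply/val_inj; rewrite /= -divn_eq. Qed.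

Lemma of_digits_inj a b a' b' :
  of_digits a b = of_digits a' b' -> a = a' /\ b = b'.
Proof.
move=> e; split; first by rewrite -(of_digitsK1 a b) e of_digitsK1.
by rewrite -(of_digitsK2 a b) e of_digitsK2.
Qed.

Fact digitwise_inj :
  injective (fun y => of_digits (s1 (lowdigit y)) (s2 (highdigit y))).
Proof.
move=> y y' /of_digits_inj[/perm_inj e1 /perm_inj e2].
by rewrite -(digitsK y) e1 e2 digitsK.
Qed.
Definition digitwise : 'S_(n1 * n2)%N := perm digitwise_inj.

Lemma digitwiseE a b : digitwise (of_digits a b) = of_digits (s1 a) (s2 b).
Proof. by rewrite permE of_digitsK1 of_digitsK2. Qed.

(** The high digit is shifted by the carry, which depends on the low digit alone. *)
Lemma shiftX_of_digits j a b :
  (shift (n1 * n2)%N ^+ j) (of_digits a b)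
    = of_digits ((shift n1 ^+ j) a) ((shift n2 ^+ ((a + j) %/ n1)) b).
Proof.
set y := LHS; rewrite -(digitsK y); congr of_digits; apply/val_inj.
  by rewrite /= /y !val_shiftX /= modn_dvdm ?dvdn_mulr // -addnA modnMDl.
by rewrite /= /y !val_shiftX /= [(n1 * n2)%N]mulnC -modn_divl -addnA divnMDl.
Qed.

End Product.

Lemma odd_perm_digitwise n1 n2 (s1 : 'S_n1) (s2 : 'S_n2)
    (n1_gt0 : 0 < n1) :
    odd n1 -> odd n2 ->
  odd_perm (digitwise s1 s2 n1_gt0) = odd_perm s1 (+) odd_perm s2.
Proof.
move=> o1 o2.
(* Each factor moves one digit only and is thus fibred over an odd number of values of the other. *)
have -> : digitwise s1 s2 n1_gt0
    = digitwise s1 1 n1_gt0 * digitwise 1 s2 n1_gt0.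
  apply/permP=> y; rewrite permM -(digitsK n1_gt0 y) !digitwiseE.
  by rewrite !perm1.
rewrite odd_permM; congr (_ (+) _).
  apply: (@odd_perm_fibred _ _ _ (@of_digits n1 n2)).
  - exact: of_digits_inj.
  - move=> y; exists (lowdigit n1_gt0 y), (highdigit n1_gt0 y).
    by rewrite digitsK.
  - by move=> a b; rewrite digitwiseE perm1.
  - by rewrite card_ord.
apply: (@odd_perm_fibred _ _ _ (fun b a => of_digits a b)).
- by move=> b a b' a' /(of_digits_inj n1_gt0)[-> ->].
- move=> y; exists (highdigit n1_gt0 y), (lowdigit n1_gt0 y).
  by rewrite digitsK.
- by move=> b a; rewrite digitwiseE perm1.
- by rewrite card_ord.
Qed.

(* Over the fixed low digit the return map is an element of the coset of s2,
   and over any other the cycle length is a multiple of an even number. *)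
Lemma witness_type_digitwise n1 n2 (s1 : 'S_n1) (s2 : 'S_n2)
    (n1_gt0 : 0 < n1) :
  witness_type s1 -> witness_type s2 ->
  witness_type (digitwise s1 s2 n1_gt0).
Proof.
move=> w1 w2 _ /mem_shift_coset[j ->].
(* The coset element is a skew product: [t1] acts on the low digit, and [t2 a], in the coset of
   [s2], on the high digit above [a]. *)
pose t1 := shift n1 ^+ j * s1.
pose t2 (a : 'I_n1) := shift n2 ^+ ((a + j) %/ n1) * s2.
set t := _ * _; pose g := @of_digits n1 n2.
have tg a b : t (g a b) = g (t1 a) (t2 a b).
  by rewrite /t /g permM shiftX_of_digits // digitwiseE !permM.
have gS y : exists a b, y = g a b.
  by exists (lowdigit n1_gt0 y), (highdigit n1_gt0 y); rewrite /g digitsK.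
have [|a0 [t1a0 uniq1 ev1]] := w1 t1; first by apply/mem_shift_coset; exists j.
have [|b0 [t2b0 uniq2 ev2]] := w2 (t2 a0).
  by apply/mem_shift_coset; exists ((a0 + j) %/ n1).
clearbody t t1 t2.
have tgX1 i a b : exists b', (t ^+ i) (g a b) = g ((t1 ^+ i) a) b'.
  elim: i => [|i [b' IH]]; first by exists b; rewrite !perm1.
  by exists (t2 ((t1 ^+ i) a) b'); rewrite !expgSr !permM IH tg.
have tgX2 i b : (t ^+ i) (g a0 b) = g a0 ((t2 a0 ^+ i) b).
  by elim: i => [|i IH]; rewrite ?perm1 // !expgSr !permM IH tg t1a0.
exists (g a0 b0); split=> [|y|y].
- by rewrite tg t1a0 t2b0.
- have [a [b ->]] := gS y; rewrite tg => /(of_digits_inj n1_gt0)[/uniq1 ->].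
  by move=> /uniq2 ->.
have [a [b ->]] := gS y => ne; apply/even_porbitP => i.
have [ea|na] := eqVneq a a0.
  rewrite ea tgX2 => /(of_digits_inj n1_gt0)[_]; apply/even_porbitP/ev2.
  by apply: contraNneq ne => ->; rewrite ea.
have [b' ->] := tgX1 i a b => /(of_digits_inj n1_gt0)[e _].
by move: e; apply/even_porbitP/ev1.
Qed.

(** * Affine maps of witness type *)

Section AffineWitness.

Import GRing.Theory.
Local Open Scope ring_scope.

Lemma shiftX_addr m j (x : 'I_m.+2) : (shift m.+2 ^+ j)%g x = x + j%:R.
Proof. by apply/val_inj; rewrite val_shiftX Zp_nat /= modnDmr. Qed.

(* For x |-> u x the coset consists of the maps x |-> u (x + j); each is
   conjugate to x |-> u x by the translation taking its fixed point to 0. *)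
Lemma affine_witness_type m (u : 'I_m.+2) d :
    ~~ odd d -> (0 < d)%N ->
    (forall i y, y != 0 -> (u ^+ i * y == y) = (d %| i)%N) ->
  exists s : 'S_m.+2, witness_type s /\ odd_perm s = odd ((m.+2 - 1) %/ d).
Proof.
move=> evd d0 uP; pose R : comNzRingType := 'I_m.+2.
have ud (y : R) : u ^+ d * y = y.
  by apply/eqP; have [->|ny] := eqVneq y 0; rewrite ?mulr0 // uP.
have injU : injective (fun x : 'I_m.+2 => u * x).
  move=> x y /= e; rewrite -(ud x) -(ud y) -(prednK d0) exprSr -!mulrA.
  by rewrite e.
pose s : 'S_m.+2 := perm injU.
have tP (t : 'S_m.+2) f j : (forall x, t x = u * (x + j)) -> t f = f ->
    forall x i, (((t ^+ i)%g x == x) = (x == f) || (d %| i)%N).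
  move=> tE tf x i.
  have tX : (t ^+ i)%g x - f = u ^+ i * (x - f).
    elim: i => [|i IH]; first by rewrite perm1 mul1r.
    rewrite expgSr permM -{1}tf !tE -mulrBr exprS -mulrA -IH.
    by rewrite opprD addrACA subrr addr0.
  rewrite -(inj_eq (addIr (- f))) tX.
  have [->|ne] := eqVneq x f; first by rewrite subrr mulr0 eqxx.
  by rewrite uP // subr_eq0.
have cycle_d (t : 'S_m.+2) f j : (forall x, t x = u * (x + j)) -> t f = f ->
    forall x, x != f -> #|porbit t x| = d.
  move=> tE tf x /negbTE nx; apply/eqP; rewrite eqn_dvd -expg_porbit.
  have := tP t f j tE tf x; rewrite nx /= => tx.
  by rewrite tx dvdnn -tx expg_porbit dvdnn.
exists s; split.
  move=> _ /mem_shift_coset[j ->]; set t := (_ * _)%g.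
  have tE x : t x = u * (x + j%:R) by rewrite permM shiftX_addr permE.
  (* A fixed point [f] solves f - u f = u j. The map is injective because [d] is even, hence not 1,
     so [u] fixes no nonzero element. *)
  have injB : injective (fun y : R => y - u * y).
    move=> x y /= e; apply/eqP; rewrite -subr_eq0; apply: contraT => ne.
    have := uP 1%N _ ne; rewrite expr1 mulrBr.
    have -> : u * x - u * y == x - y.
      by rewrite eq_sym -subr_eq0 opprD addrACA -opprD e subrr.
    by move/esym; rewrite dvdn1 => /eqP d1; move: evd; rewrite d1.
  have /codomP[f ef] := injF_onto injB (u * j%:R).
  have tf : t f = f by rewrite tE mulrDr ef addrC subrK.
  exists f; split=> // [y ty|y ny]; last by rewrite (cycle_d t f j%:R).
  have := tP t f _ tE tf y 1%N; rewrite expg1 ty eqxx dvdn1.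
  by case: eqP => // _ /esym/eqP d1; move: evd; rewrite d1.
have sE x : s x = u * (x + 0) by rewrite permE addr0.
have s0 : s 0 = 0 by rewrite permE mulr0.
(* There is one fixed point and e cycles of length [d], with 1 + e d points in all; as [d] is even,
   the sign is (-1)^e. *)
have := sum_card_porbits s; rewrite (bigD1 (porbit s 0)) ?mem_porbits //=.
rewrite (porbit_fix s0) cards1 card_ord.
rewrite (eq_bigr (fun=> d)); last first.
  move=> X /andP[/imsetP[x _ ->] ne]; apply: (cycle_d s 0 0 sE s0).
  by apply: contraNneq ne => ->; rewrite (porbit_fix s0).
rewrite sum_nat_const.
set e := #|_| => ne.
have ce : #|porbits s| = e.+1.
  rewrite (cardsD1 (porbit s 0)) mem_porbits add1n; congr _.+1.
  by apply: eq_card => X; rewrite !inE (porbit_fix s0) andbC.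
rewrite /odd_perm card_ord ce -ne add1n subn1 /= mulnK //.
by rewrite oddM (negbTE evd) andbF /= negbK.
Qed.

Lemma neg_witness_type n : odd n ->
  exists s : 'S_n, witness_type s /\ odd_perm s = odd ((n - 1) %/ 2).
Proof.
case: n => [|[|m]] // on.
  (* One point is treated apart, since the ring structure is on ['I_m.+2]. *)
  exists 1%g; rewrite odd_perm1; split=> // t _; exists ord0; split=> [|y _|y].
  - exact: ord1.
  - exact: ord1.
  - by rewrite [y]ord1.
apply: (@affine_witness_type m (-1)) => // i y ny.
rewrite -signr_odd mulr_sign dvdn2; case: odd; last by rewrite eqxx.
apply: contraNF ny => /eqP e.
have : (m.+2 %| y + y)%N.
  have : y + y == 0 by rewrite -{1}e addNr.
  by [].
rewrite addnn -mul2n Gauss_dvdr ?coprimen2 //.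
by rewrite -(inj_eq val_inj) /dvdn modn_small.
Qed.

(** Stated for any [n] so that it can be transported along [pdiv p = p]: the field ['F_p] is built
    on ['Z_(pdiv p)]. *)
Definition Z_prim_root n := exists u : 'Z_n, forall i (y : 'Z_n), y != 0 ->
  (u ^+ i * y == y) = (n.-1 %| i)%N.

Lemma prime_prim_root p : prime p -> Z_prim_root p.
Proof.
move=> pr; suff : Z_prim_root (pdiv p) by rewrite pdiv_id.
have /cyclicP[u eu] := field_unit_group_cyclic [set: {unit 'F_p}]%G.
exists (val u) => i y ny.
have -> : (pdiv p).-1 = #[u]%g.
  by rewrite orderE -eu card_finField_unit card_Fp // pdiv_id.
rewrite order_dvdn -[RHS](inj_eq val_inj) FinRing.val_unitX /=.
rewrite -[X in _ == X]mul1r.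
exact: (inj_eq (@mulIf 'F_p y ny)).
Qed.

(** A primitive root permutes the p - 1 nonzero residues in a single cycle of even length. *)
Lemma prime_neg_witness p : prime p -> odd p -> exists s : 'S_p, neg_witness s.
Proof.
move=> pr op; have [u] := prime_prim_root pr.
case: p pr op u => [|[|m]] // pr op u uP.
have [//||s [ws os]] := @affine_witness_type m u m.+1 op; first exact: uP.
by exists s; split=> //; rewrite os subn1 divnn.
Qed.

End AffineWitness.

(** * Assembling the three statements *)

Lemma witnesses_mul n k : odd n -> 3 <= n ->
    (exists s : 'S_n, witness s) -> (exists s : 'S_n, neg_witness s) ->
  odd k -> 1 <= k -> h (n * k)%N = ((n * k)%N - 1) %/ 2.
Proof.
move=> on n3 [s [ws /negbTE es]] [s' [ws' os']] ok k1.
have n0 : 0 < n by apply: leq_trans n3.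
(* The map x |-> - x on k points may have either sign; the factor on n points is chosen with the
   same sign, so the product is even. *)
have [r [wr _]] := neg_witness_type ok.
apply/h_max_witness; first by rewrite oddM on.
case e: (odd_perm r); [exists (digitwise s' r n0) | exists (digitwise s r n0)].
  split; first exact: witness_type_digitwise.
  by rewrite odd_perm_digitwise // os' e.
split; first exact: witness_type_digitwise.
by rewrite odd_perm_digitwise // es e.
Qed.

Local Close Scope group_scope.

Theorem corollary5p3 :
  (forall n1 n2 : nat,
     odd n1 -> odd n2 -> 3 <= n1 -> 3 <= n2 ->
     h n1 = (n1 - 1) %/ 2 -> h n2 = (n2 - 1) %/ 2 ->
     h (n1 * n2) = (n1 * n2 - 1) %/ 2)
  /\
  (forall n : nat,
     odd n -> 3 <= n ->
     (exists s : 'S_n, witness s) -> (exists s : 'S_n, neg_witness s) ->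
     forall k : nat, odd k -> 1 <= k ->
       h (n * k) = (n * k - 1) %/ 2)
  /\
  (forall n p q : nat,
     odd n -> 0 < n ->
     prime p -> prime q -> p %| n -> q %| n ->
     p = 1 %[mod 4] -> q = 3 %[mod 4] ->
     h n = (n - 1) %/ 2).
Proof.
split; last split.
- move=> n1 n2 o1 o2 n1_ge3 _ /(h_max_witness o1)[s1 [w1 e1]] /(h_max_witness o2)[s2 [w2 e2]].
  have n1_gt0 : 0 < n1 by apply: leq_trans n1_ge3.
  apply/h_max_witness; first by rewrite oddM o1.
  exists (digitwise s1 s2 n1_gt0); split; first exact: witness_type_digitwise.
  by rewrite odd_perm_digitwise // (negbTE e1).
- by move=> n on n3 ws wns k ok k1; apply: witnesses_mul.
move=> n p q on n0 pr _ /dvdnP[k dn] _ p1 _.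
move: on n0; rewrite dn oddM => /andP[ok op].
rewrite muln_gt0 [k * p]mulnC => /andP[k0 _].
apply: witnesses_mul => //.
- exact: odd_prime_gt2.
(* As p is 1 mod 4, (p - 1) / 2 is even and x |-> - x is a witness; a primitive root gives the
   (-1)-witness. *)
- have [s [ws os]] := neg_witness_type op; exists s; split=> //.
  by rewrite os divn2; move: p1; lia.
- exact: prime_neg_witness.
Qed.
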